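(* For all positive integers $m$ and $n$, the grid graph $P_m\times P_n$ is neighborhood-prime.
   Context: All graphs are finite and simple; $[N]=\{1,\dots,N\}$; $N(v)$ is the set of neighbors of $v$. A neighborhood-prime labeling of a graph $G$ of order $N$ is a bijection $f:V(G)\to[N]$ such that for every vertex $v$ of degree greater than $1$, $\gcd\{f(u):u\in N(v)\}=1$; a graph is neighborhood-prime if it has such a labeling. $P_m$ denotes the path on $m$ vertices and $\times$ denotes the Cartesian product of graphs. *)

(* Defs.v *)
From mathcomp Require Import all_boot.

Set Implicit Arguments.
Unset Strict Implicit.
Unset Printing Implicit Defensive.

Record sgraph (T : finType) := SGraph {
  adj : rel T;
  adj_sym : symmetric adj;
  adj_irrefl : irreflexive adj
}.

Definition nbhd (T : finType) (G : sgraph T) (v : T) : {set T} :=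
  [set u | adj G v u].

Definition degree (T : finType) (G : sgraph T) (v : T) : nat := #|nbhd G v|.

(* The first two clauses say that [f] is a bijection from the vertex set onto
   {1, ..., N}, where N = #|T|. Since 0 is neutral for [gcdn], the big operator
   is the gcd of the set of labels of the neighbors of [v]. *)
Definition nbhd_prime_labeling (T : finType) (G : sgraph T) (f : T -> nat)
    : Prop :=
  [/\ injective f,
      forall k : nat, (0 < k <= #|T|) <-> (exists v : T, f v = k)
    & forall v : T, 1 < degree G v ->
        \big[gcdn/0]_(u in nbhd G v) f u = 1].

Definition neighborhood_prime (T : finType) (G : sgraph T) : Prop :=
  exists f : T -> nat, nbhd_prime_labeling G f.

Definition path_adj (m : nat) : rel 'I_m :=
  fun i j => (i.+1 == j :> nat) || (j.+1 == i :> nat).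

Lemma path_adj_sym (m : nat) : symmetric (@path_adj m).
Proof. by move=> i j; rewrite /path_adj orbC. Qed.

Lemma path_adj_irrefl (m : nat) : irreflexive (@path_adj m).
Proof. by move=> i; rewrite /path_adj orbb gtn_eqF. Qed.

Definition path_graph (m : nat) : sgraph 'I_m :=
  SGraph (@path_adj_sym m) (@path_adj_irrefl m).

Definition cart_adj (T U : finType) (G : sgraph T) (H : sgraph U)
    : rel (T * U)%type :=
  fun x y => ((x.1 == y.1) && adj H x.2 y.2) || (adj G x.1 y.1 && (x.2 == y.2)).

Lemma cart_adj_sym (T U : finType) (G : sgraph T) (H : sgraph U) :
  symmetric (cart_adj G H).
Proof.
by move=> x y; rewrite /cart_adj adj_sym (adj_sym G) eq_sym (eq_sym x.2).
Qed.

Lemma cart_adj_irrefl (T U : finType) (G : sgraph T) (H : sgraph U) :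
  irreflexive (cart_adj G H).
Proof. by move=> x; rewrite /cart_adj !adj_irrefl andbF. Qed.

Definition cart_prod (T U : finType) (G : sgraph T) (H : sgraph U)
    : sgraph (T * U)%type :=
  SGraph (cart_adj_sym G H) (cart_adj_irrefl G H).

(* Main.v *)
Require Import Defs.
From mathcomp Require Import all_boot.
From mathcomp Require Import order zify.

(** In a grid, the right and lower neighbors of a cell are adjacent cells of one
antidiagonal [i + j = d], and so are its left and upper neighbors.  If the
cells are therefore listed antidiagonal by antidiagonal, each one run through
from end to end, then every cell having both a right and a lower neighbor, or
both a left and an upper one, sees two consecutive labels, which are coprime.

When both sides are at least 2, this leaves only the corners [(0, n-1)] and
[(m-1, 0)].  The order of the antidiagonals and the direction of each of them
are still free, and serve these two corners.  Assume [m <= n], exchanging the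
factors if needed.  Antidiagonal [m-2] comes first, from [(m-2, 0)] on, so that
this neighbor of [(m-1, 0)] has label 1.  Antidiagonals [n-2] and [n] follow
each other, the former ending at [(0, n-2)] and the latter starting at
[(1, n-1)], so that the two neighbors of [(0, n-1)] have consecutive labels.
These demands are compatible: [m-2] is not [n], and when [m = n] the
antidiagonal [m-2 = n-2] comes first and [n] second.

When [m = 1] the grid is a path, and one labels the vertices of even position
in order, then those of odd position: the two neighbors of an inner vertex
have consecutive labels.

Both labelings rank the cells by a pair of numbers compared lexicographically;
[neighborhood_prime_by_key] reduces the theorem to comparisons of keys. *)

Set Implicit Arguments.
Unset Strict Implicit.
Unset Printing Implicit Defensive.

Import Order.Theory.

(** * Labeling by rank *)

Section Rank.
Variables (T : finType) (disp : Order.disp_t) (K : orderType disp).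
Variable key : T -> K.

Definition rank (v : T) : nat := #|[set u | (key u < key v)%O]|.+1.

Lemma rank_lt u v : (key u < key v)%O -> rank u < rank v.
Proof.
move=> uv; rewrite ltnS; apply: proper_card; apply/properP; split.
  by apply/subsetP => w; rewrite !inE => /lt_trans; apply.
by exists u; rewrite inE ?ltxx.
Qed.

Lemma rank_inj : injective key -> injective rank.
Proof.
move=> key_inj u v ruv; apply: key_inj; apply/eqP.
by case: ltgtP => // /rank_lt; rewrite ruv ltnn.
Qed.

Lemma rank_le v : rank v <= #|T|.
Proof.
rewrite -cardsT; apply: proper_card; apply/properP; split; first exact: subsetT.
by exists v; rewrite inE ?ltxx.
Qed.

Lemma rank_onto : injective key ->
  forall k, (0 < k <= #|T|) <-> (exists v, rank v = k).
Proof.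
move=> key_inj k; split=> [/andP[k_gt0 k_le]|[v <-]]; last exact: rank_le.
pose r v : 'I_#|T| := Ordinal (rank_le v).
have r_inj : injective r by move=> u v [ruv]; apply: rank_inj (eq_S _ _ ruv).
have k1 : k.-1 < #|T| by rewrite prednK.
have /codomP[v /(congr1 val) /= kv] := inj_card_onto r_inj
  (eq_leq (card_ord _)) (Ordinal k1).
by exists v; rewrite -[k]prednK // kv.
Qed.

Lemma rank_min v : (forall u, (key v <= key u)%O) -> rank v = 1.
Proof.
move=> v_min; congr S; apply: eq_card0 => u.
by rewrite inE ltNge v_min.
Qed.

Definition next_key (u v : T) : Prop :=
  (key u < key v)%O /\ forall w, ~~ (key u < key w < key v)%O.

Lemma rank_next u v : injective key -> next_key u v -> rank v = (rank u).+1.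
Proof.
move=> key_inj [uv between]; congr S.
suff -> : [set w | (key w < key v)%O] = u |: [set w | (key w < key u)%O].
  by rewrite cardsU1 inE ltxx.
apply/setP => w; rewrite !inE -(inj_eq key_inj) -le_eqVlt.
apply/idP/idP => [wv|/le_lt_trans]; last exact.
by move: (between w); rewrite wv andbT -leNgt.
Qed.

End Rank.

Lemma nbhd_gcd1 (T : finType) (G : sgraph T) (f : T -> nat) (v x y : T) :
  adj G v x -> adj G v y -> coprime (f x) (f y) ->
  \big[gcdn/0]_(u in nbhd G v) f u = 1.
Proof.
move=> vx vy /eqP fxy; apply/eqP; rewrite -dvdn1 -fxy dvdn_gcd.
by apply/andP; split; [apply: (@biggcdn_inf _ x)|apply: (@biggcdn_inf _ y)];
  rewrite ?inE.
Qed.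

Lemma nbhd_gcd1_label1 (T : finType) (G : sgraph T) (f : T -> nat) (v x : T) :
  adj G v x -> f x = 1 -> \big[gcdn/0]_(u in nbhd G v) f u = 1.
Proof. by move=> vx fx; apply: (nbhd_gcd1 vx vx); rewrite fx. Qed.

(** What the rank labeling achieves at [v] is seen on keys alone: a neighbor of
least key has label 1, and neighbors with successive keys have consecutive
labels. *)
Lemma neighborhood_prime_by_key (T : finType) (G : sgraph T)
    (disp : Order.disp_t) (K : orderType disp) (key : T -> K) :
  injective key ->
  (forall v, 1 < degree G v ->
     (exists2 x, adj G v x & forall u, (key x <= key u)%O) \/
     (exists x y, [/\ adj G v x, adj G v y & next_key key x y])) ->
  neighborhood_prime G.
Proof.
move=> key_inj good; exists (rank key); split.
- exact: rank_inj.
- exact: rank_onto.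
move=> v /good[[x vx x_min]|[x [y [vx vy xy]]]].
  exact: nbhd_gcd1_label1 vx (rank_min x_min).
by apply: (nbhd_gcd1 vx vy); rewrite (rank_next key_inj xy) coprimenS.
Qed.

(** * Exchanging the factors *)

Lemma cart_prod_swap (T U : finType) (G : sgraph T) (H : sgraph U) :
  neighborhood_prime (cart_prod G H) -> neighborhood_prime (cart_prod H G).
Proof.
pose sw (A B : Type) (x : A * B) := (x.2, x.1).
have swK A B : cancel (@sw A B) (@sw B A) by case.
have adj_sw x y :
    adj (cart_prod H G) x y = adj (cart_prod G H) (sw _ _ x) (sw _ _ y).
  by rewrite /= /cart_adj /= orbC andbC [in X in _ || X]andbC.
move=> [f [f_inj f_onto f_gcd]]; exists (f \o sw _ _); split.
- exact: inj_comp f_inj (can_inj (@swK _ _)).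
- move=> k; rewrite card_prod mulnC -card_prod; split.
    by move=> /f_onto[v <-]; exists (sw _ _ v); rewrite /= swK.
  by move=> [v <-]; apply/f_onto; exists (sw _ _ v).
have nbhd_sw v : nbhd (cart_prod H G) v =i
    [pred u | sw _ _ u \in nbhd (cart_prod G H) (sw _ _ v)].
  by move=> u; rewrite !inE adj_sw.
move=> v deg_v.
rewrite -(f_gcd (sw _ _ v)).
  rewrite [RHS](reindex (@sw U T)); last by apply/onW_bij/Bijective; apply: swK.
  by apply: eq_bigl => u; rewrite nbhd_sw inE.
apply: leq_trans deg_v _; rewrite /degree.
rewrite -(card_imset _ (can_inj (@swK U T))); apply/subset_leq_card/subsetP.
by move=> _ /imsetP[u + ->]; rewrite nbhd_sw.
Qed.

(** * Lexicographic keys on a grid *)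

Definition lex_key (T : Type) (a b : T -> nat) (v : T) : (nat *l nat)%type :=
  (a v, b v).

Lemma lex_key_le (T : Type) (a b : T -> nat) u v :
  (lex_key a b u <= lex_key a b v)%O =
  (a u < a v) || (a u == a v) && (b u <= b v).
Proof. by rewrite lexi_pair !leEnat; lia. Qed.

Lemma lex_key_lt (T : Type) (a b : T -> nat) u v :
  (lex_key a b u < lex_key a b v)%O =
  (a u < a v) || (a u == a v) && (b u < b v).
Proof. by rewrite ltxi_pair !leEnat ltEnat /=; lia. Qed.

Lemma grid_adjE m n (x y : 'I_m * 'I_n) :
  adj (cart_prod (path_graph m) (path_graph n)) x y =
  (x.1 == y.1 :> nat) && ((x.2.+1 == y.2 :> nat) || (y.2.+1 == x.2 :> nat)) ||
  ((x.1.+1 == y.1 :> nat) || (y.1.+1 == x.1 :> nat)) && (x.2 == y.2 :> nat).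
Proof. by []. Qed.

(** * Paths *)

Definition parity_key n : 'I_1 * 'I_n -> (nat *l nat)%type :=
  lex_key (fun v : 'I_1 * 'I_n => odd v.2 : nat) (fun v => v.2 : nat).

Lemma parity_key_inj n : injective (@parity_key n).
Proof.
move=> [i j] [k l] [_ /= /val_inj ->].
by rewrite (ord1 i) (ord1 k).
Qed.

Lemma path_degree_gt1 n (i : 'I_1) (j : 'I_n) :
  1 < degree (cart_prod (path_graph 1) (path_graph n)) (i, j) ->
  0 < j /\ j.+1 < n.
Proof.
move=> /card_gt1P[[k x] [[l y] []]].
rewrite !inE !grid_adjE xpair_eqE (ord1 i) (ord1 k) (ord1 l) eqxx /=.
by have := ltn_ord x; have := ltn_ord y; rewrite -(inj_eq val_inj) /=; lia.
Qed.

Lemma path_neighborhood_prime n :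
  neighborhood_prime (cart_prod (path_graph 1) (path_graph n)).
Proof.
apply: (neighborhood_prime_by_key (@parity_key_inj n)) => -[i j].
move=> /path_degree_gt1[j_gt0 j_lt]; right.
have j_pred : j.-1 < n by lia.
exists (i, Ordinal j_pred), (i, Ordinal j_lt).
rewrite !grid_adjE /next_key /parity_key lex_key_lt /=.
split; [lia|lia|split=> [|[k l]]; first by lia].
by rewrite !lex_key_lt /=; lia.
Qed.

(** * Grids with both sides at least 2 *)

(** The position of antidiagonal [d] in the list.  The two corners only
constrain the head of the list; the shift by 3 keeps the rest clear of it.  When
[m = n] no antidiagonal has position 1, so that positions 0 and 2 are then
successive. *)
Definition diag_place (m n d : nat) : nat :=
  if d.+2 == m then 0 else if d.+2 == n then 1 else if d == n then 2 else d.+3.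

Lemma diag_place_inj m n : injective (diag_place m n).
Proof. by move=> d e; rewrite /diag_place; repeat case: ifP; lia. Qed.

(** Antidiagonal [n] is run through from its upper end and all others from
their lower end, so that [n] begins beside the corner where [n-2] ends. *)
Definition diag_key m n : 'I_m * 'I_n -> (nat *l nat)%type :=
  lex_key (fun v : 'I_m * 'I_n => diag_place m n (v.1 + v.2))
          (fun v => if v.1 + v.2 == n then v.1 : nat else v.2 : nat).

Lemma diag_key_inj m n : injective (@diag_key m n).
Proof.
move=> [i j] [k l] [/= /diag_place_inj dd pp].
by congr (_, _); apply: val_inj => /=; move: pp; rewrite -dd; case: ifP; lia.
Qed.

(** Only cells of one antidiagonal share a position, and among these the second
component of the key is a coordinate, which changes by one between [x] and [y];
hence no key falls strictly between theirs. *)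
Lemma diag_key_next m n (x y : 'I_m * 'I_n) :
  x.1 = y.1.+1 :> nat -> y.2 = x.2.+1 :> nat ->
  next_key (@diag_key m n) x y \/ next_key (@diag_key m n) y x.
Proof.
case: x y => [i j] [k l] /= ik lj; have dd : i + j = k + l by lia.
have [dn|dn] := eqVneq (k + l) n; [right|left].
all: split=> [|[p q]]; rewrite /diag_key !lex_key_lt /= ?dd ?dn ?(negPf dn).
all: rewrite ?eqxx; first lia.
all: apply/negP => between.
all: have /diag_place_inj dw : diag_place m n (p + q) = diag_place m n (k + l).
all: try (rewrite ?dn; lia).
all: move: between; rewrite dw ?dn ?eqxx ?(negPf dn); lia.
Qed.

Lemma grid_neighborhood_prime m n : 1 < m -> m <= n ->
  neighborhood_prime (cart_prod (path_graph m) (path_graph n)).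
Proof.
move=> m_gt1 m_le_n.
apply: (neighborhood_prime_by_key (@diag_key_inj m n)) => -[i j] _.
have i_lt := ltn_ord i; have j_lt := ltn_ord j.
have same_diag (x y : 'I_m * 'I_n) :
    x.1 = y.1.+1 :> nat -> y.2 = x.2.+1 :> nat ->
    adj (cart_prod (path_graph m) (path_graph n)) (i, j) x ->
    adj (cart_prod (path_graph m) (path_graph n)) (i, j) y ->
    exists x y, [/\ adj (cart_prod (path_graph m) (path_graph n)) (i, j) x,
      adj (cart_prod (path_graph m) (path_graph n)) (i, j) y &
      next_key (@diag_key m n) x y].
  by move=> x1 y2 vx vy; have [xy|yx] := diag_key_next x1 y2;
    [exists x, y|exists y, x].
have [/andP[i1 j1]|] := boolP ((i.+1 < m) && (j.+1 < n)).
  by right; apply: (same_diag (Ordinal i1, j) (i, Ordinal j1)) => //;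
    rewrite grid_adjE /=; lia.
have [/andP[i_gt0 j_gt0] _|] := boolP ((0 < i) && (0 < j)).
  have i1 : i.-1 < m by lia.
  have j1 : j.-1 < n by lia.
  right; apply: (same_diag (i, Ordinal j1) (Ordinal i1, j));
    rewrite ?grid_adjE /=; lia.
(* The two remaining corners: [(m-1, 0)], with a neighbor labeled 1, then
[(0, n-1)], whose neighbors end one antidiagonal and start the next in the
list. *)
have [j0 _ i_max|j_gt0 i0 j_max] := posnP j.
  have m2 : m - 2 < m by lia.
  left; exists (Ordinal m2, j); first by rewrite grid_adjE /=; lia.
  move=> [k l]; rewrite /diag_key lex_key_le /= /diag_place j0.
  by repeat case: ifP; lia.
have n2 : n - 2 < n by lia.
have i1 : i.+1 < m by lia.
right; exists (i, Ordinal n2), (Ordinal i1, j).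
rewrite !grid_adjE /next_key /diag_key lex_key_lt /=.
split; [lia|lia|split=> [|[k l]]].
  by rewrite /diag_place; repeat case: ifP; lia.
have := ltn_ord k; have := ltn_ord l.
rewrite !lex_key_lt /= /diag_place; repeat case: ifP; lia.
Qed.

Theorem theorem14 (m n : nat) (hm : 0 < m) (hn : 0 < n) :
  neighborhood_prime (cart_prod (path_graph m) (path_graph n)).
Proof.
wlog m_le_n : m n hm hn / m <= n.
  move=> th; have [|/ltnW nm] := leqP m n; first exact: th.
  by apply: cart_prod_swap; apply: th.
move: hm m_le_n; rewrite leq_eqVlt => /predU1P[<- _|].
  exact: path_neighborhood_prime.
exact: grid_neighborhood_prime.
Qed.
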